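(* Let $G$ be a finite abelian $p$-group ($p$ prime) with exponent $q$, let $d=\lceil \mathsf D^*(G)/q\rceil$, and suppose $p>d(d-1)$. Then $\mathsf s_{kq}(G)\leq kq+\mathsf D^*(G)-1$ for every integer $k>\frac{d(d-1)}{2}$.
   Context: If $G\cong C_{n_1}\oplus\cdots\oplus C_{n_r}$ with $1\leq n_1\mid\cdots\mid n_r$ ($C_n$ cyclic of order $n$), then $\mathsf D^*(G)=1+\sum_{i=1}^r(n_i-1)$. A sequence over $G$ is a finite unordered list (multiset) of elements of $G$; it is zero-sum if its terms sum to $0$. For an integer $L\geq 0$, $\mathsf s_L(G)$ is the minimal integer $\ell$ such that every sequence of $\ell$ terms from $G$ has a zero-sum subsequence of length exactly $L$. *)

(* Defs.v *)
From mathcomp Require Import all_boot all_order all_algebra all_fingroup all_solvable.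

Set Implicit Arguments.
Unset Strict Implicit.
Unset Printing Implicit Defensive.

Import GRing.Theory.
Local Open Scope ring_scope.

(* A finZmodType carries the finGroupType structure whose law is +, so that   *)
(* exponent, abelian_type and p.-group apply to [set: G].                     *)
(* abelian_type lists the invariant factors n_i > 1; allowing some n_i to be  *)
(* 1 would not change the sum.                                                *)
Definition Dstar (G : finZmodType) : nat :=
  (1 + \sum_(n <- abelian_type [set: G]) (n - 1))%N.

(* Unordered sequences are represented by lists: reordering changes neither   *)
(* sums nor, up to permutation, the collection of subsequences.               *)
Definition zero_sum (G : zmodType) (s : seq G) : Prop := \sum_(x <- s) x = 0.

Definition forces_zero_sum (G : finZmodType) (L l : nat) : Prop :=
  forall s : seq G, size s = l ->
    exists t : seq G, [/\ subseq t s, size t = L & zero_sum t].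

(* m = s_L(G).  The minimum need not exist for every L (there is none unless  *)
(* exponent [set: G] %| L), hence a relation rather than a function.          *)
Definition is_s_const (G : finZmodType) (L m : nat) : Prop :=
  forces_zero_sum G L m /\ forall l : nat, forces_zero_sum G L l -> (m <= l)%N.

(* Main.v *)
(* Let D = D*(G).  For a function f on N x G with values in F_p, the          *)
(* differences along (1, g), for g in S, sum f with signs over the pairs      *)
(* (|T|, sum T), T running over the subsequences of S.  Taking for f the      *)
(* indicator of "sum zero and length jq" times P(j), deg P < t, the function  *)
(* is killed by tq differences along (1, 0) and by ord(b) differences along   *)
(* (0, b) for b in a basis of G, so the signed sum vanishes as soon as        *)
(* |S| >= tq + D - 1.  With P = prod_(a in A) (X - a), |A| < t and p dividing *)
(* no a in A, some zero-sum subsequence has length jq with j > 0 outside A.   *)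
(*   Now let |S| = kq + D - 1, k <= p, have no zero-sum subsequence of length *)
(* kq, and let B be the set of e in [1, d-1] for which length (k + e)q may    *)
(* still occur.  Unless p = k + e for such an e, some length aq with a in B   *)
(* occurs, since otherwise only k - 1 multiples of q are possible lengths;    *)
(* removing such a subsequence replaces k by k - a and B by B \ {a}.  If pq   *)
(* does occur, some a < d, a != e, can be removed while keeping B.  As the    *)
(* elements of B add up to at most d(d-1)/2 < k and p > d(d-1), the sum of B  *)
(* stays below k, and the descent ends in a contradiction.                    *)

Require Import Defs.
From mathcomp Require Import all_boot all_order all_algebra all_fingroup all_solvable.
From mathcomp Require Import zify.

Set Implicit Arguments.
Unset Strict Implicit.
Unset Printing Implicit Defensive.

Import Order.TTheory GRing.Theory Num.Theory.
Local Open Scope ring_scope.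

(** Differences commute, and those along (1, g) need only be tested on generators: (1, g) is a sum
    of (1, 0) and of basis elements (0, b) ([diffs_span]), and among enough generators one reaches
    its killing bound by pigeonhole ([diffs_generators]). In characteristic p suitable bounds are t
    * q for (1, 0) and the order of b for (0, b) ([iter_diff_pchar]). Diminished by 1 each, they add
    up to t * q + D - 2, whence [zero_sum_lengths]. For k at most p, the descent on k is
    [no_exceptional_lengths], with [small_length] treating the length p * q; larger k follow in
    [zsub_kq] by splitting off zero-sum pieces. *)

(** * Finite differences on a commutative monoid *)

Section Differences.

Variables (H : nmodType) (V : zmodType).
Implicit Types (f : H -> V) (g : H) (l : seq H).

Definition diff g f : H -> V := fun x => f (x + g) - f x.

Definition diffs l f : H -> V := foldl (fun h g => diff g h) f l.

Lemma eq_diff g f f' : f =1 f' -> diff g f =1 diff g f'.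
Proof. by move=> e x; rewrite /diff !e. Qed.

Lemma eq_diffs l f f' : f =1 f' -> diffs l f =1 diffs l f'.
Proof. by elim: l f f' => //= g l IH f f' e; apply: IH; apply: eq_diff. Qed.

Lemma eq_iter_diff n g f f' :
  f =1 f' -> iter n (diff g) f =1 iter n (diff g) f'.
Proof. by move=> e; elim: n => //= n IH; apply: eq_diff. Qed.

Lemma diff0 g f : f =1 (fun=> 0) -> diff g f =1 (fun=> 0).
Proof. by move=> f0 x; rewrite /diff !f0 subrr. Qed.

Lemma diffs0 l f : f =1 (fun=> 0) -> diffs l f =1 (fun=> 0).
Proof. by elim: l f => //= g l IH f f0; apply: IH; apply: diff0. Qed.

Lemma diffC g g' f : diff g (diff g' f) =1 diff g' (diff g f).
Proof. by move=> x; rewrite /diff (addrAC x) !opprB addrACA [RHS]addrACA (addrC (- _)). Qed.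

Lemma iter_diffC n g g' f :
  iter n (diff g) (diff g' f) =1 diff g' (iter n (diff g) f).
Proof.
elim: n => //= n IH x.
by rewrite (eq_diff _ IH) diffC.
Qed.

Lemma diffsC g l f : diffs l (diff g f) =1 diff g (diffs l f).
Proof.
elim: l f => //= h l IH f x.
by rewrite -IH; apply: eq_diffs; apply: diffC.
Qed.

Lemma diffs_filter (a : pred H) l f :
  diffs (filter a l) f =1 (fun=> 0) -> diffs l f =1 (fun=> 0).
Proof.
elim: l f => //= g l IH f; case: (a g) => /= [|f0 x]; first exact: IH.
rewrite diffsC; apply: diff0; exact: IH.
Qed.

Lemma diffs_count n g l f :
  iter n (diff g) f =1 (fun=> 0) -> (n <= count_mem g l)%N ->
  diffs l f =1 (fun=> 0).
Proof.
elim: l n f => /= [|h l IH] n f f0.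
  by rewrite leqn0 => /eqP n0; move: f0; rewrite n0.
have [-> | _] /= := eqVneq h g.
  case: n f0 => [|n] f0 n_le.
    by apply: diffs0; apply: diff0.
  apply: (IH n) n_le => x; rewrite iter_diffC; exact: f0.
by rewrite add0n => n_le x; rewrite diffsC; apply: diff0; exact: IH n_le.
Qed.

(* Pigeonhole: some [e] of [E] occurs in [l] at least as often as its bound. *)
Lemma diffs_generators (E : seq (H * nat)) f l :
    {in E, forall em, iter em.2 (diff em.1) f =1 (fun=> 0)} ->
    {subset l <= unzip1 E} -> (\sum_(em <- E) em.2.-1 < size l)%N ->
  diffs l f =1 (fun=> 0).
Proof.
elim: E l => [|[e m] E IH] l f0 lE; first by case: l lE => // g l /(_ g (mem_head _ _)).
rewrite big_cons /= => sz_l.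
have /= em0 := f0 _ (mem_head _ _).
have [m_le | m_gt] := leqP m (count_mem e l); first exact: diffs_count m_le.
apply: (@diffs_filter (predC1 e)); apply: IH.
- by move=> em emE; apply: f0; rewrite inE emE orbT.
- move=> g; rewrite mem_filter /= => /andP[ne_g /lE].
  by rewrite inE (negPf ne_g).
- rewrite size_filter -(ltn_add2l (count_mem e l)) (count_predC (pred1 e)).
  by apply: leq_ltn_trans sz_l; rewrite leq_add2r -ltnS (ltn_predK m_gt).
Qed.

Lemma diff_sum l h :
    {in l, forall g, diff g h =1 (fun=> 0)} ->
  diff (\sum_(g <- l) g) h =1 (fun=> 0).
Proof.
move=> h0 x; apply/eqP; rewrite subr_eq0; apply/eqP.
elim: l h0 x => [|g l IH] h0 x; first by rewrite big_nil addr0.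
rewrite big_cons addrA IH => [|g' g'l]; last by apply: h0; rewrite inE g'l orbT.
by apply/eqP; rewrite -subr_eq0; apply/eqP; apply: h0; rewrite mem_head.
Qed.

(* The key point: once [n] generators have been applied, the result [h] is   *)
(* killed by every generator, hence translation invariant.                   *)
Lemma diffs_span (E : seq H) f l :
    {in l, forall g, exists2 r, {subset r <= E} & g = \sum_(e <- r) e} ->
    (forall l', {subset l' <= E} -> size l' = size l -> diffs l' f =1 (fun=> 0)) ->
  diffs l f =1 (fun=> 0).
Proof.
elim: l f => [|g l IH] f lE f0; first exact: (f0 [::]).
apply: (IH (diff g f)) => [g' g'l | l' l'E sz_l' x].
  by apply: lE; rewrite inE g'l orbT.
rewrite diffsC; have [r rE ->] := lE g (mem_head _ _).
apply: diff_sum => e /rE eE y; rewrite -diffsC.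
apply: (f0 (e :: l')) => [e'|] /=; last by rewrite sz_l'.
by rewrite inE => /predU1P[-> | /l'E].
Qed.

(* In both lemmas, [diffs l f x] is, up to sign, the alternating sum of the  *)
(* values [f (x + \sum_(g <- u) g)] over the subsequences [u] of [l].        *)
Lemma diffs_subseq0 l f x :
  (forall u, subseq u l -> f (x + \sum_(g <- u) g) = 0) -> diffs l f x = 0.
Proof.
elim: l f => [|g l IH] f f0.
  by have := f0 [::] (eqxx _); rewrite big_nil addr0.
apply: IH => u ul; rewrite /diff f0 ?(subseq_trans ul (subseq_cons _ _)) // subr0.
by have := f0 (g :: u); rewrite big_cons addrCA addrC /= eqxx; apply.
Qed.

Lemma diffs_subseq l f x :
    (forall u, subseq u l -> (0 < size u)%N -> f (x + \sum_(g <- u) g) = 0) ->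
  diffs l f x = 0 -> f x = 0.
Proof.
elim: l f => // g l IH f f0 df0.
have {}df0 : diff g f x = 0.
  apply: IH df0 => u ul u_gt0.
  rewrite /diff f0 ?(subseq_trans ul (subseq_cons _ _)) // subr0.
  by have := f0 (g :: u); rewrite big_cons addrCA addrC /= eqxx; apply.
move: df0; rewrite /diff.
have := f0 [:: g]; rewrite /= eqxx sub0seq big_seq1 => -> //.
by rewrite sub0r => /eqP; rewrite oppr_eq0 => /eqP.
Qed.

End Differences.

(** * Iterated differences in characteristic p *)

Section Frobenius.

Variables (H : nmodType) (R : comNzRingType).

(* [P] evaluated at the translation by [e], applied to [f].                  *)
Definition shift_poly (P : {poly R}) (e : H) (f : H -> R) : H -> R :=
  fun x => \sum_(i < size P) P`_i * f (x + e *+ i).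

Lemma shift_poly_wide (P : {poly R}) e f x n : (size P <= n)%N ->
  shift_poly P e f x = \sum_(i < n) P`_i * f (x + e *+ i).
Proof.
move=> le_n; rewrite /shift_poly (big_ord_widen _ (fun i => P`_i * f (x + e *+ i)) le_n).
rewrite big_mkcond; apply: eq_bigr => i _; case: ltnP => // le_i.
by rewrite nth_default ?mul0r.
Qed.

Lemma shift_polyMXsub1 (P : {poly R}) e f :
  shift_poly (P * ('X - 1)) e f =1 diff e (shift_poly P e f).
Proof.
move=> x; rewrite mulrBr mulr1 /diff.
set n := (size P).+1.
have szX : (size (P * 'X)%R <= n)%N.
  by rewrite (leq_trans (size_polyMleq _ _)) // size_polyX addn2.
have szD : (size (P * 'X - P)%R <= n)%N.
  by rewrite (leq_trans (size_polyD _ _)) // geq_max szX size_polyN /= leqnSn.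
rewrite (shift_poly_wide _ _ _ szD) (shift_poly_wide _ _ x (leqnSn (size P))).
transitivity (\sum_(i < n) (P * 'X)`_i * f (x + e *+ i)
              - \sum_(i < n) P`_i * f (x + e *+ i)).
  by rewrite -sumrB; apply: eq_bigr => i _; rewrite coefB mulrBl.
congr (_ - _); rewrite big_ord_recl coefMX eqxx mul0r add0r.
by apply: eq_bigr => i _; rewrite coefMX /= -addrA -mulrS.
Qed.

Lemma iter_diff_poly n e (f : H -> R) :
  iter n (diff e) f =1 shift_poly (('X - 1) ^+ n) e f.
Proof.
elim: n => [|n IH] x; last by rewrite exprSr shift_polyMXsub1 -(eq_diff _ IH).
rewrite expr0 /shift_poly size_poly1 big_ord1 coef1 eqxx mul1r.
by rewrite mulr0n addr0.
Qed.

(** For such [n], Frobenius gives (X - 1)^n = X^n - 1, where X acts as translation by [e]. *)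
Lemma iter_diff_pchar n e (f : H -> R) :
  [pchar R].-nat n -> iter n (diff e) f =1 diff (e *+ n) f.
Proof.
move=> charn x; rewrite iter_diff_poly.
have n_gt0 : (0 < n)%N by case/andP: charn.
have -> : ('X - 1) ^+ n = 'X^n - 1 :> {poly R}.
  have charXn : [pchar {poly R}].-nat n by rewrite (eq_pnat _ (pchar_poly R)).
  by rewrite exprDn_pchar // exprNn_pchar // expr1n.
rewrite (@shift_poly_wide _ _ _ _ n.+1) ?size_Xn_sub_1 // big_ord_recr /=.
rewrite coefB coefXn eqxx coef1 (gtn_eqF n_gt0) subr0 mul1r /diff addrC.
case: n n_gt0 {charn} => // n _; rewrite big_ord_recl coefB coefXn coef1 /= sub0r.
rewrite mulr0n addr0 mulN1r big1 ?addr0 // => i _.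
by rewrite coefB coefXn coef1 /= /bump /= add1n eqSS (ltn_eqF (ltn_ord i)) subr0 mul0r.
Qed.

End Frobenius.

(** * Zero-sum subsequences of a given length *)

Section ZeroSum.

Variable G : finZmodType.
Implicit Types (s u : seq G) (L j k : nat).

(** Quantifying over masks, a finite type, makes the property decidable. *)
Definition zsub s L : bool :=
  [exists m : (size s).-tuple bool,
    (size (mask m s) == L) && (\sum_(x <- mask m s) x == 0)].

Lemma zsubP s L :
  reflect (exists t, [/\ subseq t s, size t = L & zero_sum t]) (zsub s L).
Proof.
apply: (iffP existsP) => [[m /andP[/eqP sz /eqP z0]] | [t [/subseqP[m sz_m ->] sz z0]]].
  by exists (mask m s); rewrite mask_subseq.
by exists (tcast sz_m (in_tuple m)); rewrite val_tcast /= sz eqxx; apply/eqP.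
Qed.

(** Multiplicities suffice, so that subsequences can be removed and recombined without regard to
    order. *)
Lemma zsub_count s u :
  (forall x, count_mem x u <= count_mem x s)%N -> zero_sum u -> zsub s (size u).
Proof.
move=> /count_subseqP[t ts ut] z0; apply/zsubP; exists t.
by rewrite (perm_size ut) /zero_sum -(perm_big _ ut).
Qed.

Lemma zsub_le s L : zsub s L -> (L <= size s)%N.
Proof. by case/zsubP=> t [/size_subseq ts <- _]. Qed.

Lemma zsub_subseq s s' L : subseq s s' -> zsub s L -> zsub s' L.
Proof.
move=> ss' /zsubP[t [ts szt z0]]; apply/zsubP; exists t.
by rewrite (subseq_trans ts).
Qed.

Lemma zsub_compl s L : zero_sum s -> zsub s L -> zsub s (size s - L).
Proof.
move=> z0 /zsubP[t [/perm_to_subseq[r rs] <- t0]].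
rewrite (perm_size rs) size_cat addKn; apply: zsub_count => [x|].
  by rewrite (seq.permP rs) count_cat leq_addl.
by move: z0; rewrite /zero_sum (perm_big _ rs) big_cat /= t0 add0r.
Qed.

Lemma zsub_remove s L : zsub s L -> exists r,
  [/\ size r = (size s - L)%N, forall L', zsub r L' -> zsub s L' &
     forall L', zsub r L' -> zsub s (L' + L)].
Proof.
move=> /zsubP[t [/perm_to_subseq[r rs] <- t0]]; exists r; split=> [|L'|L'].
- by rewrite (perm_size rs) size_cat addKn.
- case/zsubP=> u [ur <- u0]; apply: zsub_count => // x.
  rewrite (seq.permP rs) count_cat (leq_trans _ (leq_addl _ _)) //.
  by move: x; apply/count_subseqP; exists u.
- case/zsubP=> u [ur <- u0]; rewrite addnC -size_cat; apply: zsub_count => [x|].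
    rewrite (seq.permP rs) !count_cat leq_add2l.
    by move: x; apply/count_subseqP; exists u.
  by rewrite /zero_sum big_cat /= t0 u0 addr0.
Qed.

End ZeroSum.

(** * Polynomial weights and zero-sum lengths outside a prescribed set *)

Section Weights.

Variables (G : finZmodType) (p : nat).
Hypothesis p_prime : prime p.
Implicit Types (P : {poly 'F_p}) (s u : seq G).

Definition weight q P (x : nat * G) : 'F_p :=
  if (q %| x.1)%N && (x.2 == 0) then P.[(x.1 %/ q)%:R] else 0.

Lemma eq_weight0 q : weight q 0 =1 (fun=> 0).
Proof. by move=> x; rewrite /weight horner0; case: ifP. Qed.

Lemma diff_weight q P : (0 < q)%N ->
  diff ((q, 0) : nat * G) (weight q P) =1 weight q (P \Po ('X + 1) - P).
Proof.
move=> q_gt0 [n g]; rewrite /diff /weight /= addr0.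
rewrite -[n + q]/(n + q)%N dvdn_addl // divnDr // divnn q_gt0.
case: ifP => _; last by rewrite subr0.
by rewrite hornerD hornerN horner_comp hornerD hornerX hornerC natrD.
Qed.

(** P(X + 1) and P have the same degree and leading coefficient, so the top terms cancel. *)
Lemma size_poly_diff P n :
  (size P <= n.+1)%N -> (size (P \Po ('X + 1) - P)%R <= n)%N.
Proof.
have sz1 : size ('X + 1 : {poly 'F_p})%R = 2 by rewrite size_XaddC.
move=> szP; apply/leq_sizeP => j; rewrite leq_eqVlt => /predU1P[<- | lt_nj].
  rewrite coefB; have [szPn | szPn] := leqP (size P) n.
    by rewrite !nth_default ?subrr ?size_comp_poly2.
  have {szPn}szP : size P = n.+1 by apply/eqP; rewrite eqn_leq szP.
  have nP : n = (size P).-1 by rewrite szP.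
  rewrite [in X in X - _]nP -(size_comp_poly2 P sz1) nP -!lead_coefE.
  by rewrite lead_coef_comp ?sz1 // lead_coefXaddC expr1n mulr1 subrr.
by rewrite nth_default // (leq_trans (size_polyD _ _)) //
  size_polyN size_comp_poly2 // maxnn (leq_trans szP).
Qed.

Lemma iter_diff_weight t q P : (0 < q)%N -> (size P <= t)%N ->
  iter t (diff ((q, 0) : nat * G)) (weight q P) =1 (fun=> 0).
Proof.
move=> q_gt0; elim: t P => [|t IH] P szP x.
  by move: szP; rewrite leqn0 size_poly_eq0 => /eqP ->; apply: eq_weight0.
rewrite iterSr (eq_iter_diff _ _ (diff_weight P q_gt0)).
by apply: IH; apply: size_poly_diff.
Qed.

Lemma pair_mulrn (H K : nmodType) (a : H) (b : K) n :
  (a, b) *+ n = (a *+ n, b *+ n) :> H * K.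
Proof. by elim: n => [|n IH]; rewrite ?mulr0n // !mulrS IH. Qed.

Lemma sum_pair (H K : nmodType) I (l : seq I) (a : I -> H) (b : I -> K) :
  \sum_(i <- l) (a i, b i) = (\sum_(i <- l) a i, \sum_(i <- l) b i) :> H * K.
Proof. by elim: l => [|i l IH]; rewrite ?big_nil // !big_cons IH. Qed.

Lemma basis_span (b : seq G) g :
  g \in (\prod_(x <- b) <[x]>)%g -> exists2 r, {subset r <= b} & g = \sum_(x <- r) x.
Proof.
elim: b g => [|x b IH] g.
  by rewrite big_nil => /set1gP ->; exists [::]; rewrite // big_nil.
rewrite big_cons => /mulsgP[_ h /cycleP[n ->] /IH[r rb ->] ->].
exists (nseq n x ++ r) => [y|].
  by rewrite mem_cat mem_nseq inE => /orP[/andP[_ ->] | /rb ->] //; rewrite orbT.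
by rewrite big_cat big_nseq iter_addr_0.
Qed.

Lemma zero_sum_lengths t q s (A : seq nat) :
    (p.-group [set: G])%g -> (p.-nat q)%N ->
    (t * q + Dstar G - 1 <= size s)%N -> (size A < t)%N ->
    {in A, forall a, ~~ (p %| a)%N} ->
  exists j, [/\ (0 < j)%N, j \notin A & zsub s (j * q)].
Proof.
move=> pG q_pnat sz_s sz_A pA.
have q_gt0 : (0 < q)%N by case/andP: q_pnat.
have pcharFp : p \in [pchar 'F_p] by apply: pchar_Fp.
have pcharFpE n : (p.-nat n)%N -> [pchar 'F_p].-nat n.
  by apply: sub_in_pnat => r _ /eqnP ->.
have [/existsP[j /and3P[j_gt0 jA sj]] | none] :=
  boolP [exists j : 'I_(size s).+1, [&& (0 < j)%N, (j : nat) \notin A & zsub s (j * q)]].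
  by exists j.
(* P vanishes on [A] but not at 0: if every positive j came from [A], the empty subsequence would
   give the only nonzero term of a vanishing alternating sum. *)
pose P : {poly 'F_p} := \prod_(a <- A) ('X - (a%:R)%:P).
have szP : (size P <= t)%N by rewrite size_prod_XsubC.
have P0 : P.[0] != 0.
  rewrite horner_prod prodf_seq_neq0; apply/allP => a /pA; apply: contra.
  by rewrite hornerXsubC sub0r oppr_eq0 (dvdn_pcharf pcharFp).
have [b defG ordb] := abelian_structure (FinRing.zmod_abelian [set: G]).
case/negP: P0; apply/eqP.
have <- : weight q P 0 = P.[0] by rewrite /weight /= dvdn0 eqxx div0n.
pose l := [seq (1, g) : nat * G | g <- s].
apply: (@diffs_subseq _ _ l) => [_ /subseqP[m sz_m ->]|].
  rewrite -map_mask size_map add0r big_map sum_pair /weight /=.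
  set u := mask m s => u_gt0; case: ifP => // /andP[/dvdnP[j sz_u] /eqP u0].
  rewrite sz_u mulnK //.
  have {}sz_u : size u = (j * q)%N by rewrite -sz_u; exact/esym/sum1_size.
  suff jA : j \in A.
    apply/eqP; rewrite horner_prod prodf_seq_eq0.
    by apply/hasP; exists j; rewrite // hornerXsubC subrr.
  have sj : zsub s (j * q).
    by apply/zsubP; exists u; split=> //; exact: mask_subseq.
  have j_gt0 : (0 < j)%N by case: j sz_u {sj} u_gt0 => // ->.
  apply: contraNT none => jA; apply/existsP.
  have jP : (j < (size s).+1)%N.
    by rewrite ltnS (leq_trans _ (zsub_le sj)) // leq_pmulr.
  by exists (Ordinal jP); rewrite /= j_gt0 jA.
(* The q-th iterate along (1, 0) is the difference along (q, 0), which lowers the degree of P; t of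
   these kill the weight. Along (0, x), the iterate of order [#[x]] is the difference along 0. *)
pose E := ((1, 0), (t * q)%N) :: [seq ((0, x), #[x]%g) | x <- b] : seq ((nat * G) * nat).
apply: (@diffs_span _ _ (unzip1 E)) => [_ /mapP[g gs ->] | l' l'E sz_l'].
  have [r rb ->] : exists2 r, {subset r <= b} & g = \sum_(x <- r) x.
    by apply: basis_span; rewrite (bigdprodW defG) inE.
  exists ((1, 0) :: [seq (0, x) | x <- r]) => [y|].
    rewrite !inE => /orP[-> // | /mapP[x /rb xb ->]]; apply/orP; right.
    by apply/mapP; exists ((0, x), #[x]%g); rewrite ?(map_f (fun x => ((0, x), #[x]%g))).
  by rewrite big_cons big_map sum_pair big1_eq; congr (_, _); rewrite /= ?addr0 ?add0r.
apply: (@diffs_generators _ _ E) => [em||] //.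
  rewrite inE => /predU1P[-> | /mapP[x xb ->]] /=.
    move=> x; rewrite iterM -(iter_diff_weight q_gt0 szP x).
    move: x; elim: {1 2}t => //= n IH x.
    rewrite iter_diff_pchar ?pcharFpE // pair_mulrn mul0rn.
    by rewrite (eq_diff _ IH) -[1 *+ q]/(q%:R) natn.
  move=> y; rewrite iter_diff_pchar.
    by rewrite pair_mulrn mul0rn -FinRing.zmodXgE expg_order /diff addr0 subrr.
  by apply: pcharFpE; apply: mem_p_elt pG _; rewrite inE.
rewrite sz_l' size_map big_cons big_map /=.
move: sz_s; rewrite /Dstar -ordb big_map; under eq_bigr do rewrite subn1.
rewrite addnCA add1n subn1 /=; apply: leq_trans.
by rewrite -addSn prednK // muln_gt0 q_gt0 andbT (leq_ltn_trans _ sz_A).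
Qed.

End Weights.

(** * The descent on k *)

Section Descent.

Variables (G : finZmodType) (p q d : nat).
Hypotheses (p_prime : prime p) (pG : (p.-group [set: G])%g).
Hypotheses (q_pnat : (p.-nat q)%N) (leDdq : (Dstar G <= d * q)%N).
Hypothesis p_large : (d * d.-1 < p)%N.

Lemma Dstar_gt0 : (0 < Dstar G)%N.
Proof. by rewrite /Dstar add1n. Qed.

(* Deleting one term from a zero-sum sequence of length [p * q] leaves a      *)
(* sequence with no zero-sum subsequence of length [k * q] nor, taking        *)
(* complements, of length [e * q].                                            *)
Lemma small_length k e (s : seq G) : (k + e)%N = p -> (0 < e < d)%N -> (e < k)%N ->
    ~~ zsub s (k * q) -> zsub s (p * q) ->
  exists a, [/\ (0 < a < d)%N, a != e & zsub s (a * q)].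
Proof.
move=> kep /andP[e_gt0 lt_ed] lt_ek sk /zsubP[[|g u] [us sz_u u0]].
  by case/andP: q_pnat => q_gt0 _; move: sz_u (prime_gt0 p_prime) => /=; nia.
have q_gt0 : (0 < q)%N by case/andP: q_pnat.
have us' : subseq u s by apply: subseq_trans us; apply: subseq_cons.
have missing j : (0 < j < p)%N -> ~~ zsub s ((p - j) * q) -> ~~ zsub u (j * q).
  move=> jp; apply: contra => uj; apply: zsub_subseq us _.
  by rewrite mulnBl -sz_u; apply: zsub_compl => //; apply: zsub_subseq uj; apply: subseq_cons.
have uk : ~~ zsub u (k * q) by apply: contra sk; apply: zsub_subseq.
have ue : ~~ zsub u (e * q).
  by apply: missing; [lia | rewrite -[(p - e)%N](_ : k = _) //; lia].
(* As [u] has p * q - 1 terms and D <= d * q, t = p - d is allowed. The interval [d, p - 1] has p -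
   d elements, one too many; omitting k, which [uk] excludes anyway, leaves room. *)
have [|||a [a_gt0 aA ua]] := @zero_sum_lengths G p p_prime (p - d) q u
  [seq j <- iota d (p - d) | j != k] pG q_pnat.
- have := Dstar_gt0; move: sz_u leDdq => /=; rewrite mulnBl; nia.
- rewrite size_filter -[X in (_ < X)%N](size_iota d (p - d)).
  rewrite -(count_predC (pred1 k) (iota d (p - d))) -[X in (X < _)%N]add0n ltn_add2r.
  rewrite -has_count has_pred1 mem_iota; nia.
- move=> a; rewrite mem_filter mem_iota => /andP[_ a_p]; rewrite gtnNdvd //; nia.
have lt_ap : (a < p)%N.
  by rewrite -(ltn_pmul2r q_gt0) -sz_u /= ltnS; apply: zsub_le.
have ak : a != k by apply: contraNneq uk => <-.
exists a; split; [| |exact: zsub_subseq us' ua].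
  by move: aA; rewrite mem_filter mem_iota ak /=; lia.
by apply: contraNneq ue => <-.
Qed.

Lemma no_exceptional_lengths k (B : seq nat) (s : seq G) :
    (k <= p)%N -> uniq B -> {in B, forall e, 0 < e < d}%N ->
    (sumn B < k)%N -> (2 * sumn B <= d * d.-1)%N ->
    (k * q + Dstar G - 1 <= size s)%N ->
    (forall j, (0 < j)%N -> zsub s (j * q) ->
       (j < k)%N \/ exists2 e, e \in B & j = (k + e)%N) ->
  False.
Proof.
have q_gt0 : (0 < q)%N by case/andP: q_pnat.
elim/ltn_ind: k B s => k IH B s le_kp uB Bd lt_Bk le_Bd sz_s sA.
have sk : ~~ zsub s (k * q).
  apply/negP => /sA[|| [e eB]]; try lia.
  by have := Bd e eB; lia.
have le_sumn e : e \in B -> (e <= sumn B)%N.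
  by move=> eB; rewrite (perm_sumn (perm_to_rem eB)) /= leq_addr.
(* Removing a zero-sum subsequence of length [a * q] passes from [k] to       *)
(* [k - a], and [B] can only shrink.                                          *)
have step a (B' : seq nat) : zsub s (a * q) -> (0 < a)%N -> uniq B' ->
    {subset B' <= B} -> (forall e, e \in B -> e \notin B' -> e = a) ->
    (sumn B' < k - a)%N -> (sumn B' <= sumn B)%N -> False.
  move=> sa a_gt0 uB' sB'B BB' lt_B'k le_B'B.
  have [r [sz_r sr sra]] := zsub_remove sa.
  apply: (IH (k - a)%N _ B' r) => //; try lia.
  - by move=> e /sB'B; apply: Bd.
  - move=> j j_gt0 rj.
    have : zsub s ((j + a) * q) by rewrite mulnDl; apply: sra.
    case/sA => [| lt_jk | [e eB ej]]; first lia.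
      by left; lia.
    have [eB' | eB'] := boolP (e \in B'); first by right; exists e => //; lia.
    have ea := BB' _ eB eB'; case/negP: sk; apply: sr.
    by have <- : j = k by lia.
(* The length p * q is treated apart, because p divides p and so cannot be put into [A] below. *)
have [/hasP[e eB /andP[/eqP kep sp]] | no_p] :=
    boolP (has (fun e => (k + e == p)%N && zsub s (p * q)) B).
  have [|//|//|a [ad ae sa]] := @small_length k e s kep (Bd e eB).
    by have := le_sumn e eB; lia.
  apply: (step a B) => //; [lia| | ].
    by move=> e' -> .
  (* Since [a] and [e] are distinct and below d, a + e <= 2d - 3, and d(d-1)/2 + 2d - 3 <= d(d-1) <
     p because (d-2)(d-3) >= 0. Hence the sum of [B] is below p - e - a = k - a. *)
  have := Bd e eB; nia.
have [/hasP[a aB sa] | no_a] := boolP (has (fun a => zsub s (a * q)) B).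
  have /perm_sumn /= sumB := perm_to_rem aB.
  apply: (step a (rem a B)) => //.
  - by have := Bd a aB; lia.
  - exact: rem_uniq.
  - by move=> e /mem_rem.
  - by move=> e eB; rewrite mem_rem_uniq // !inE eB andbT negbK => /eqP.
  - lia.
  - lia.
(* All remaining possible lengths: each e in [B] is dropped from [1, k - 1] and replaced by at most
   k + e, so at most k - 1 stay. As k + e < 2p, only k + e = p would be divisible by p. *)
pose A := [seq j <- iota 1 k.-1 | j \notin B] ++
          [seq j <- [seq (k + e)%N | e <- B] | j != p].
have [|a|j [j_gt0 jA sj]] := zero_sum_lengths p_prime pG q_pnat sz_s (A := A).
- have sub : {subset B <= iota 1 k.-1}.
    by move=> e eB; rewrite mem_iota; have := Bd e eB; have := le_sumn e eB; lia.
  have : (size [seq j <- iota 1 k.-1 | j \notin B] + size B = k.-1)%N.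
    have -> : size B = count (mem B) (iota 1 k.-1).
      rewrite -size_filter; apply/perm_size/uniq_perm => // [|e].
        by rewrite filter_uniq ?iota_uniq.
      by rewrite mem_filter; apply/idP/andP => [eB | []//]; split=> //; apply: sub.
    by rewrite size_filter addnC count_predC size_iota.
  move=> szB; apply: (@leq_ltn_trans k.-1); last by rewrite prednK // (leq_ltn_trans _ lt_Bk).
  rewrite size_cat -[X in (_ <= X)%N]szB leq_add2l size_filter.
  by rewrite -[X in (_ <= X)%N](size_map (fun e => k + e)%N) count_size.
- rewrite mem_cat !mem_filter mem_iota => /orP[/andP[_ a_k] | /andP[ap /mapP[e eB ae]]].
    by rewrite gtnNdvd //; lia.
  have := Bd e eB => ed; apply/negP => /dvdnP[c ac].
  have := le_sumn e eB; move: ap ac; rewrite ae => ap ac.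
  by case: c ac => [|[|c]] ac le_e; move: ap; rewrite ?ac ?mul1n ?eqxx //; nia.
- case: (sA j j_gt0 sj) => [lt_jk | [e eB je]].
    move: jA; rewrite mem_cat mem_filter negb_or mem_iota.
    have -> : (0 < j < 1 + k.-1)%N by lia.
    rewrite andbT negbK => /andP[jB _]; case/hasP: no_a; by exists j.
  move: jA; rewrite mem_cat !mem_filter negb_or je map_f // andbT negbK.
  move=> /andP[_ /eqP kep]; case/hasP: no_p; exists e => //.
  by rewrite kep eqxx -kep -je.
Qed.

Lemma sumn_iota1 n : (2 * sumn (iota 1 n) = n.+1 * n)%N.
Proof.
elim: n => // n IH.
by rewrite -{1}[n.+1]addn1 iotaD sumn_cat mulnDr IH /= addn0; nia.
Qed.

(** Since D <= d * q, [s] has fewer than (k + d) * q terms, so the descent can start with B =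
    [1, d - 1], of sum d(d-1)/2 < k. *)
Lemma zsub_kq_le k (s : seq G) :
    (d * d.-1 < 2 * k)%N -> (k <= p)%N -> (size s = k * q + Dstar G - 1)%N ->
  zsub s (k * q).
Proof.
move=> k_large le_kp sz_s; have [//|sk] := boolP (zsub s (k * q)); exfalso.
have q_gt0 : (0 < q)%N by case/andP: q_pnat.
have d_gt0 : (0 < d)%N by move: leDdq Dstar_gt0; case: (d); lia.
have sumB := sumn_iota1 d.-1; rewrite prednK // in sumB.
apply: (@no_exceptional_lengths k (iota 1 d.-1) s) => //.
- exact: iota_uniq.
- by move=> e; rewrite mem_iota; lia.
- by lia.
- by rewrite sumB.
- by rewrite sz_s.
move=> j j_gt0 sj; have [ltjk | | jk] := ltngtP j k; [by left | | by rewrite -jk sj in sk].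
move=> lt_kj; right; exists (j - k)%N; last by rewrite subnKC // ltnW.
have lt_j : (j < k + d)%N.
  rewrite -(ltn_pmul2r q_gt0) mulnDl (leq_ltn_trans (zsub_le sj)) // sz_s.
  by move: Dstar_gt0 leDdq; lia.
by rewrite mem_iota; lia.
Qed.

(* Values of [k] beyond [p] are reached by repeatedly removing a zero-sum     *)
(* subsequence for the least admissible value [K].                            *)
Lemma zsub_kq k (s : seq G) :
    (d * d.-1 < 2 * k)%N -> (size s = k * q + Dstar G - 1)%N ->
  zsub s (k * q).
Proof.
elim/ltn_ind: k s => k IH s k_large sz_s.
have [le_kp | lt_pk] := leqP k p; first exact: zsub_kq_le.
have q_gt0 : (0 < q)%N by case/andP: q_pnat.
pose K := (d * d.-1)./2.+1.
have eK := odd_double_half (d * d.-1).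
have K_large : (d * d.-1 < 2 * K)%N by rewrite /K; lia.
have le_Kp : (K <= p)%N by rewrite /K; lia.
have le_Kk : (K * q <= k * q)%N by rewrite leq_mul2r; lia.
have sK : zsub s (K * q).
  apply: (zsub_subseq (take_subseq s (K * q + Dstar G - 1))); apply: zsub_kq_le => //.
  by rewrite size_take_min sz_s; lia.
have [r [sz_r _ srK]] := zsub_remove sK.
have -> : (k * q = (k - K) * q + K * q)%N by rewrite -mulnDl subnK //; lia.
(* As d(d-1) is even, k > p > d(d-1) = 2(K - 1) gives k >= 2K, so k - K >= K is still admissible. *)
apply: srK; apply: IH; [lia | by rewrite /K; lia |].
by rewrite sz_r sz_s mulnBl; have := Dstar_gt0; lia.
Qed.

End Descent.

(** * Deciding the forcing property, so that a least length can be extracted *)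

Lemma forces_zero_sumP (G : finZmodType) (L l : nat) :
  reflect (forces_zero_sum G L l) [forall s : l.-tuple G, zsub s L].
Proof.
apply: (iffP forallP) => [f s sz_s | f s]; last by apply/zsubP/f/size_tuple.
have sz : size s == l by apply/eqP.
exact/zsubP/(f (Tuple sz)).
Qed.

Theorem theorem1p9 (G : finZmodType) (p q : nat) (d : int)
    (p_prime : prime p)
    (pG : (p.-group [set: G])%g)
    (q_def : q = exponent [set: G])
    (d_def : d = Num.ceil ((Dstar G)%:R / q%:R : rat))
    (p_large : d * (d - 1) < p%:Z)
    (k : nat)
    (k_large : (d * (d - 1))%:~R / 2 < k%:R :> rat) :
  exists s : nat,
    is_s_const G (k * q) s /\ (s <= k * q + Dstar G - 1)%N.
Proof.
have q_pnat : (p.-nat q)%N by rewrite q_def pnat_exponent.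
have q_gt0 : (0 < q)%N by case/andP: q_pnat.
have qQ_gt0 : 0 < q%:R :> rat by rewrite ltr0n.
have le_d : (Dstar G)%:R / q%:R <= d%:~R :> rat by rewrite d_def Num.Theory.ceil_ge.
have d_gt0 : 0 < d.
  rewrite -(ltr_int rat); apply: lt_le_trans le_d.
  by rewrite divr_gt0 // ltr0n Dstar_gt0.
case: d d_gt0 {d_def} le_d p_large k_large => // [[|d]] // _ le_d p_large k_large.
have eB : d.+1%:Z - 1 = d%:Z by lia.
have leDdq : (Dstar G <= d.+1 * q)%N.
  by rewrite -(ler_nat rat) natrM -ler_pdivrMr.
have p_lt : (d.+1 * d < p)%N by move: p_large; rewrite eB -PoszM ltz_nat.
have k_lt : (d.+1 * d < 2 * k)%N.
  by move: k_large; rewrite eB -PoszM ltr_pdivrMr // -natrM -pmulrn ltr_nat [(k * 2)%N]mulnC.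
have ex : exists l, [forall s : l.-tuple G, zsub s (k * q)].
  exists (k * q + Dstar G - 1)%N; apply/forallP => s.
  by apply: (@zsub_kq G p q d.+1) => //; rewrite size_tuple.
case: (ex_minnP ex) => m /forces_zero_sumP m_forces m_min.
exists m; split; first by split=> // l /forces_zero_sumP; apply: m_min.
apply: m_min; apply/forallP => s.
by apply: (@zsub_kq G p q d.+1) => //; rewrite size_tuple.
Qed.
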